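(* Let $X$ and $Y$ be Banach spaces and $(a,b)\in S_{X\oplus_1 Y}$, where $a\in X\setminus\{0\}$ and $b\in Y\setminus\{0\}$. Then $(a,b)\in\mathrm{SCD}(B_{X\oplus_1 Y})$ if and only if $\frac{a}{\|a\|}\in\mathrm{SCD}(B_X)$ and $\frac{b}{\|b\|}\in\mathrm{SCD}(B_Y)$.
   Context: Banach spaces are over $\mathbb{K}=\mathbb{R}$ or $\mathbb{C}$; $B_X$, $S_X$, $X^*$ denote the closed unit ball, the unit sphere and the topological dual of $X$. A slice of a bounded set $A\subseteq X$ is a non-empty intersection of $A$ with an open half-space; it can be written as $S(A,x^*,\alpha)=\{x\in A:\operatorname{Re}x^*(x)>\sup_{b\in A}\operatorname{Re}x^*(b)-\alpha\}$ with $x^*\in X^*$, $\alpha>0$. Let $A\subseteq X$ be bounded and convex and $a\in A$. A countable collection $\{V_n:n\in\mathbb{N}\}$ of non-empty subsets of $A$ is determining for $a$ if $a\in\overline{\mathrm{conv}}(B)$ whenever $B\subseteq A$ intersects all the sets $V_n$. The point $a$ is an SCD point (slicely countably determined point) of $A$ if there is a sequence of slices of $A$ that is determining for $a$; $\mathrm{SCD}(A)$ is the set of all SCD points of $A$. $X\oplus_1 Y$ is the product space $X\times Y$ with norm $\|(x,y)\|_1=\|x\|+\|y\|$. *)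

(* Defs.v *)
From HB Require Import structures.
From mathcomp Require Import all_boot all_order all_algebra.
From mathcomp Require Import all_classical all_reals all_analysis.
From mathcomp Require Import complex.

Set Implicit Arguments.
Unset Strict Implicit.
Unset Printing Implicit Defensive.

Import Order.TTheory GRing.Theory Num.Theory.
Import numFieldNormedType.Exports.

Local Open Scope classical_set_scope.
Local Open Scope ring_scope.

(* [scalar_field re]: K is the field of real or of complex numbers, and re is
   the real part. *)
Inductive scalar_field (R : realType) : forall K : numFieldType, (K -> R) -> Prop :=
| scalar_field_real : @scalar_field R R (fun x => x)
| scalar_field_complex : @scalar_field R R[i] (@complex.Re R).

(* An alias is needed because the canonical norm on X * Y is the max norm. *)
Definition l1sum (K : numFieldType) (X Y : normedModType K) : Type :=
  (X * Y)%type.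

Section l1sum_normedModType.
Variables (K : numFieldType) (X Y : normedModType K).

Definition l1norm (z : l1sum X Y) : K := `|z.1| + `|z.2|.

HB.instance Definition _ := GRing.Lmodule.copy (l1sum X Y) (X * Y)%type.

Let ler_l1normD (z w : l1sum X Y) : l1norm (z + w) <= l1norm z + l1norm w.
Proof. by rewrite /l1norm addrACA lerD// ler_normD. Qed.

Let l1normZ (l : K) (z : l1sum X Y) : l1norm (l *: z) = `|l| * l1norm z.
Proof. by rewrite /l1norm !normrZ mulrDr. Qed.

Let l1norm_eq0 (z : l1sum X Y) : l1norm z = 0 -> z = 0.
Proof.
move/eqP; rewrite /l1norm paddr_eq0// !normr_eq0.
by case: z => x y /= /andP[/eqP-> /eqP->].
Qed.

HB.instance Definition _ :=
  Lmodule_isNormed.Build K (l1sum X Y) ler_l1normD l1normZ l1norm_eq0.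

End l1sum_normedModType.

Definition unit_ball (K : numFieldType) (X : normedModType K) : set X :=
  [set x | `|x| <= 1].

Definition unit_sphere (K : numFieldType) (X : normedModType K) : set X :=
  [set x | `|x| = 1].

Arguments unit_ball {K} X.
Arguments unit_sphere {K} X.

Definition conv_hull (K : numFieldType) (X : normedModType K) (B : set X) :
  set X := smallest (@convex_set K X) B.

Section SCD.
Variables (R : realType) (K : numFieldType) (re : K -> R).
Variable X : normedModType K.
Implicit Types (A B S : set X) (a : X) (V : (set X)^nat).

(* Slices and SCD points are meant for bounded A, for which the supremum
   exists. *)
Definition slice A (f : X -> K) (alpha : R) : set X :=
  [set x | A x /\ sup [set re (f b) | b in A] - alpha < re (f x)].

Definition is_slice A S : Prop :=
  exists (f : {linear X -> K^o}) (alpha : R),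
    [/\ continuous f, 0 < alpha & S = slice A f alpha].

Definition determining A a V : Prop :=
  (forall n, V n !=set0 /\ V n `<=` A) /\
  forall B, B `<=` A -> (forall n, B `&` V n !=set0) ->
    closure (conv_hull B) a.

Definition SCD A : set X :=
  [set a | A a /\ exists V, (forall n, is_slice A (V n)) /\ determining A a V].

End SCD.

(* Main.v *)
From HB Require Import structures.
Require Import Defs.
From mathcomp Require Import all_boot all_order all_algebra.
From mathcomp Require Import all_classical all_reals all_analysis.
From mathcomp Require Import complex ring lra.

Set Implicit Arguments.
Unset Strict Implicit.
Unset Printing Implicit Defensive.

Import Order.TTheory GRing.Theory Num.Theory.
Import numFieldNormedType.Exports.

Local Open Scope classical_set_scope.
Local Open Scope ring_scope.

(** Write Z for the l1-sum of X and Y.  Both directions rest on how a functional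
    h = (f, g) sees the unit ball of Z, which is the convex hull of the two axes
    balls B_X x {0} and {0} x B_Y.

    From the factors to Z.  The SCD points of a convex set form a convex set
    ([convex_SCD], by interleaving two sequences of slices), and
    (a, b) = |a| (a/|a|, 0) + |b| (0, b/|b|) with |a| + |b| = 1, so it suffices
    to show that (a', 0) is an SCD point of B_Z whenever a' <> 0 is one of B_X
    ([SCD_l1sum_inl]); the other axis follows by swapping the factors.  A slice
    of B_Z cut by (f, 0) very close to the supremum s > 0 of Re f forces |x| to
    be close to 1, hence |y| to be close to 0.  So below each slice V_n of a
    determining sequence for a' there are slices T_(n,k) of B_Z whose points
    (x, y) satisfy x in V_n and |y| < 1/(k+1) ([slice_l1sum_near_axis]).  If B
    meets all T_(n,k), then the x for which B has a point (x, y) with |y| small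
    meet all V_n, so their convex combinations approach a', and the
    corresponding combinations of points of B approach (a', 0).

    From Z to the factors.  A slice of B_Z has to meet one of the two axes balls
    ([slice_l1sum_meets_axes]): what it leaves of B_Z is convex, and would be
    all of B_Z if it contained both of them.  Those slices S_n that meet
    B_X x {0} trace slices V_n on B_X.
    If B is a subset of B_X that meets these V_n, then the union of B x {0} and
    {0} x B_Y meets all S_n, so (a, b) is a limit of points (s u, t v) with u in
    conv B, v in B_Y and s + t = 1 ([conv_hull_l1_axes]).  Then s |u| -> |a| and
    t |v| -> |b| with |a| + |b| = 1 leave no slack: s -> |a|, and therefore
    u -> a/|a| ([SCD_l1sum_fst_normalize]). *)

(** * The real part on real and complex scalars *)

Section real_part.
Variables (R : realType) (K : numFieldType) (re : K -> R).
Hypothesis hK : scalar_field re.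

Lemma reD x y : re (x + y) = re x + re y.
Proof. by case: hK x y => //= x y; rewrite raddfD. Qed.

Lemma reM_ge0 r x : 0 <= r -> re (r * x) = re r * re x.
Proof.
case: hK r x => //= -[r r'] [x x']; rewrite lecE /= => /andP[/eqP -> _].
by rewrite mul0r subr0.
Qed.

Lemma re1 : re 1 = 1. Proof. by case: hK. Qed.

Lemma re_gt0 r : 0 < r -> 0 < re r.
Proof. by case: hK r => //= -[r r']; rewrite ltcE /= => /andP[]. Qed.

Lemma re_le_norm x : re x <= re `|x|.
Proof.
case: hK x => [x|[x x']] /=; first exact: ler_norm.
rewrite (le_trans (ler_norm _))// -sqrtr_sqr ler_sqrt ?lerDl ?sqr_ge0//.
by rewrite addr_ge0 ?sqr_ge0.
Qed.

Lemma re0 : re 0 = 0.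
Proof. by apply: (addrI (re 0)); rewrite -reD !addr0. Qed.

Lemma reN x : re (- x) = - re x.
Proof. by apply/eqP; rewrite -addr_eq0 -reD addNr re0. Qed.

Lemma re_ge0 r : 0 <= r -> 0 <= re r.
Proof. by rewrite le_eqVlt => /predU1P[<-|/re_gt0/ltW//]; rewrite re0. Qed.

Lemma re_le r s : r <= s -> re r <= re s.
Proof. by rewrite -subr_ge0 => /re_ge0; rewrite reD reN subr_ge0. Qed.

(** Nonnegative scalars are comparable, so monotonicity of the real part can be
    read backwards on them. *)
Lemma lt_re r s : 0 <= r -> 0 <= s -> re r < re s -> r < s.
Proof.
move=> r0 s0 rs; rewrite real_ltNge ?ger0_real//; apply/negP => /re_le.
by rewrite leNgt rs.
Qed.

End real_part.

(** * Convex sets, convex hulls and closures in normed spaces *)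

Section convex.
Variables (K : numFieldType) (X : normedModType K).
Implicit Types (A B C : set X) (x y : X).

Lemma convex_setP A : @convex_set K X A <->
  forall x y s t, 0 <= s -> 0 <= t -> s + t = 1 -> A x -> A y ->
    A (s *: x + t *: y).
Proof.
split=> [cA x y s t s0 t0 st Ax Ay|cA x y l].
  have s1 : s <= 1 by rewrite -st lerDl.
  have := cA x y (Itv01 s0 s1); rewrite !inE => /(_ Ax Ay).
  suff -> : t = 1 - s by [].
  by rewrite -st addrC addKr.
rewrite !inE => Ax Ay; apply: cA => //; last by rewrite addrC subrK.
by rewrite subr_ge0.
Qed.

Lemma convex_conv_hull B : @convex_set K X (conv_hull B).
Proof.
apply/convex_setP => x y s t s0 t0 st Bx By C [/= cC BC].
by move/convex_setP: (cC); apply => //; [apply: Bx|apply: By].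
Qed.

Lemma sub_conv_hull B : B `<=` conv_hull B.
Proof. exact: sub_gen_smallest. Qed.

Lemma conv_hull_sub B C : @convex_set K X C -> B `<=` C -> conv_hull B `<=` C.
Proof. exact: smallest_sub. Qed.

Lemma unit_ball0 : unit_ball X 0.
Proof. by rewrite /unit_ball/= normr0. Qed.

Lemma unit_ball_normalize x : unit_ball X (`|x|^-1 *: x).
Proof.
have [->|x0] := eqVneq x 0; first by rewrite scaler0; exact: unit_ball0.
by rewrite /unit_ball/= normrZ normfV normr_id mulVf ?normr_eq0.
Qed.

Lemma normalizeK x : `|x| *: (`|x|^-1 *: x) = x.
Proof.
have [->|x0] := eqVneq x 0; first by rewrite !scaler0.
by rewrite scalerKV ?normr_eq0.
Qed.

Lemma convex_unit_ball : @convex_set K X (unit_ball X).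
Proof.
apply/convex_setP => x y s t s0 t0 st Bx By; rewrite /unit_ball/=.
rewrite (le_trans (ler_normD _ _))// !normrZ !ger0_norm// -st.
by rewrite lerD// ler_piMr.
Qed.

(** The weights s/(s + t) and t/(s + t) give w.  Stating the sum as (s + t) w
    keeps the degenerate case s + t = 0, where any point of A serves. *)
Lemma convex_scaled_sum A x y (s t : K) : @convex_set K X A -> A x -> A y ->
  0 <= s -> 0 <= t -> exists2 w, A w & s *: x + t *: y = (s + t) *: w.
Proof.
move=> /convex_setP cA Ax Ay s0 t0.
have [st0|st0] := eqVneq (s + t) 0.
  move/eqP: (st0); rewrite paddr_eq0// => /andP[/eqP-> /eqP->].
  by exists x => //; rewrite addr0 !scale0r addr0.
have st_ge0 : 0 <= s + t by rewrite addr_ge0.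
exists ((s / (s + t)) *: x + (t / (s + t)) *: y).
  by apply: cA; rewrite ?divr_ge0// -mulrDl divff.
by rewrite scalerDr !scalerA ![(s + t) * _]mulrC !divfK.
Qed.

Lemma closure_normP A x :
  closure A x <-> forall e, 0 < e -> exists2 y, A y & `|x - y| < e.
Proof.
split=> [clA e e0|clA U /nbhs_normP[e/= e0 eU]].
  have [|y [Ay xy]] := clA (fun y => `|x - y| < e); last by exists y.
  by apply/nbhs_normP; exists e.
by have [y Ay xy] := clA e e0; exists y; split=> //; exact: eU.
Qed.

Lemma convex_closure A : @convex_set K X A -> @convex_set K X (closure A).
Proof.
move=> /convex_setP cA; apply/convex_setP => x y s t s0 t0 st.
move=> /closure_normP Ax /closure_normP Ay; apply/closure_normP => e e0.
have [x' Ax' xx'] := Ax _ e0; have [y' Ay' yy'] := Ay _ e0.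
exists (s *: x' + t *: y'); first exact: cA.
rewrite opprD addrACA -!scalerBr (le_lt_trans (ler_normD _ _))// !normrZ.
rewrite !ger0_norm// -[e]mul1r -st mulrDl.
move: s0; rewrite le_eqVlt => /predU1P[s0|s0].
  move: st; rewrite -s0 add0r => ->.
  by rewrite !mul0r !mul1r !add0r.
by rewrite ltr_leD// ?ltr_pM2l// ler_wpM2l// ltW.
Qed.

End convex.

(** Coordinate maps of an l1-sum are contractions, and composing with them is how
    functionals are moved between the sum and its factors. *)
Lemma contraction_continuous (K : numFieldType) (X Y : normedModType K)
    (T : {linear X -> Y}) :
  (forall x, `|T x| <= `|x|) -> continuous T.
Proof.
move=> T1; apply/linear_bounded_continuous/bounded_funP => r.
by exists r => x; apply: le_trans.
Qed.

(** * Slices and SCD points *)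

Section SCD_unit_ball.
Variables (R : realType) (K : numFieldType) (re : K -> R).
Hypothesis hK : scalar_field re.

(** A slice described by its threshold c rather than by the distance from c to
    the supremum: in this form slices can be pulled back along linear maps and
    compared between spaces with no supremum to recompute. *)
Definition ball_slice (X : normedModType K) (f : X -> K) (c : R) : set X :=
  [set x | unit_ball X x /\ c < re (f x)].

Section slices.
Variable X : normedModType K.
Implicit Types (f : {linear X -> K^o}) (S : set X) (a : X).

Lemma has_sup_unit_ball f : continuous f ->
  has_sup [set re (f x) | x in unit_ball X].
Proof.
move=> cf; split; first by exists (re (f 0)), 0 => //; exact: unit_ball0.
have [M fM] := (bounded_funP f).2 ((linear_bounded_continuous f).2 cf) 1.
exists (re M) => _ [x x1 <-].
by rewrite (le_trans (re_le_norm hK _))// (re_le hK)// fM.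
Qed.

Lemma is_slice_ball_slice f c : continuous f -> ball_slice f c !=set0 ->
  is_slice re (unit_ball X) (ball_slice f c).
Proof.
move=> cf [x [x1 cfx]].
exists f, (sup [set re (f b) | b in unit_ball X] - c); split=> //.
  rewrite subr_gt0 (lt_le_trans cfx)//.
  by apply: sup_upper_bound; [exact: has_sup_unit_ball|exists x].
by rewrite /slice subKr.
Qed.

Lemma ball_slice_of_slice S : is_slice re (unit_ball X) S ->
  exists (f : {linear X -> K^o}) c, continuous f /\ S = ball_slice f c.
Proof. by move=> [f [al [cf _ ->]]]; eexists; eexists; split; [exact: cf|]. Qed.

Lemma is_slice_unit_ball : is_slice re (unit_ball X) (unit_ball X).
Proof.
rewrite [X in is_slice _ _ X](_ : _ =
    ball_slice (\0 : {linear X -> K^o}) (- 1)); last first.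
  apply/seteqP; split=> [x x1|x []//]; split=> //=.
  by rewrite (re0 hK) ltrN10.
apply: is_slice_ball_slice; first exact: cst_continuous.
exists 0; split; first exact: unit_ball0.
by rewrite /= (re0 hK) ltrN10.
Qed.

End slices.

(** Slices may be indexed by any countable type: interleaving two sequences
    becomes indexing by a sum, doubly indexed families by a product. *)
Lemma SCD_countable (X : normedModType K) (I : countType) (i0 : I) (A : set X)
    (a : X) (V : I -> set X) :
    A a -> (forall i, is_slice re A (V i)) -> (forall i, V i !=set0) ->
    (forall B, B `<=` A -> (forall i, B `&` V i !=set0) ->
      closure (conv_hull B) a) ->
  SCD re A a.
Proof.
move=> Aa sV V0 dV; split=> //.
exists (fun n => V (odflt i0 (unpickle n))); split=> [n //|]; split.
  move=> n; split=> //.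
  by have [f [al [_ _ ->]]] := sV (odflt i0 (unpickle n)) => x [].
move=> B BA BV; apply: dV => // i.
by have := BV (pickle i); rewrite pickleK.
Qed.

(** Joining two determining sequences makes both points limits of the convex
    hull of the same set B, and the closure of that hull is convex. *)
Lemma convex_SCD (X : normedModType K) (A : set X) :
  @convex_set K X A -> @convex_set K X (SCD re A).
Proof.
move=> cA; apply/convex_setP => x y s t s0 t0 st.
move=> [Ax [V [sV [V0 dV]]]] [Ay [W [sW [W0 dW]]]].
apply: (@SCD_countable _ _ (inl 0%N : nat + nat)%type A _
  (fun i => match i with inl n => V n | inr n => W n end)).
- by move/convex_setP: cA; apply.
- by case.
- by case=> n; [have [] := V0 n|have [] := W0 n].
move=> B BA BVW.
have /convex_setP := convex_closure (convex_conv_hull (B := B)); apply => //.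
  by apply: dV => // n; exact: (BVW (inl n)).
by apply: dW => // n; exact: (BVW (inr n)).
Qed.

(** Everything in the notion of SCD point transports along a surjective linear
    isometry; used for the swap of the two summands. *)
Lemma SCD_isometry (X Y : normedModType K) (T : {linear X -> Y})
    (T' : {linear Y -> X}) (a : X) :
    cancel T T' -> cancel T' T -> (forall x, `|T x| = `|x|) ->
  SCD re (unit_ball X) a -> SCD re (unit_ball Y) (T a).
Proof.
move=> TK T'K Tn [a1 [V [sV [V0 dV]]]].
have T'n y : `|T' y| = `|y| by rewrite -[in RHS](T'K y) Tn.
apply: (@SCD_countable _ nat 0%N _ _ (fun n => T' @^-1` V n)).
- by rewrite /unit_ball/= Tn.
- move=> n; have [f [c [cf Vn]]] := ball_slice_of_slice (sV n).
  have -> : T' @^-1` V n = ball_slice (f \o T' : {linear Y -> K^o}) c.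
    by rewrite Vn; apply/seteqP; split=> y; rewrite /ball_slice/unit_ball/= T'n.
  apply: (@is_slice_ball_slice _ (f \o T' : {linear Y -> K^o})).
    move=> y; apply: continuous_comp; last exact: cf.
    by apply: contraction_continuous => z; rewrite T'n.
  have [x] := (V0 n).1; rewrite Vn => -[x1 cx].
  by exists (T x); split; rewrite /unit_ball/= ?Tn ?TK.
- by move=> n; have [x Vx] := (V0 n).1; exists (T x); rewrite /= TK.
move=> B B1 BV.
have /closure_normP cla : closure (conv_hull (T' @` B)) a.
  apply: dV => [_ [y By <-]|n].
    by rewrite /unit_ball/= T'n; exact: B1.
  by have [y [By Vy]] := BV n; exists (T' y); split=> //; exists y.
apply/closure_normP => e /cla[x Bx ax].
exists (T x); last by rewrite -linearB Tn.
suff : conv_hull (T' @` B) `<=` [set x | conv_hull B (T x)] by apply.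
apply: conv_hull_sub => [|_ [y By <-]/=]; last first.
  by rewrite T'K; exact: sub_conv_hull.
apply/convex_setP => u v s t s0 t0 st /= Bu Bv.
rewrite linearD !linearZ.
by have /convex_setP := convex_conv_hull (B := B); apply.
Qed.

(** If no functional were positive somewhere on the ball, all slices would
    contain 0, so the set {0} would meet a determining sequence for a and a
    would be 0.  This produces a nonzero functional without the Hahn-Banach
    theorem. *)
Lemma SCD_functional_gt0 (X : normedModType K) (a : X) : a != 0 ->
  SCD re (unit_ball X) a ->
  exists (f : {linear X -> K^o}) x,
    [/\ continuous f, unit_ball X x & 0 < re (f x)].
Proof.
move=> a_neq0 [_ [V [sV [V0 dV]]]]; apply: contrapT => nf.
have /closure_normP/(_ `|a|) : closure (conv_hull [set 0]) a.
  apply: dV => [_ ->|n]; first exact: unit_ball0.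
  exists 0; split=> //.
  have [f [c [cf Vn]]] := ball_slice_of_slice (sV n).
  have [x] := (V0 n).1; rewrite Vn => -[x1 cx]; split; first exact: unit_ball0.
  rewrite linear0 (re0 hK) (lt_le_trans cx)// leNgt; apply/negP => fx.
  by apply: nf; exists f, x.
rewrite normr_gt0 => -[//|y By].
suff /(_ y By)/= -> : conv_hull [set (0 : X)] `<=` [set 0].
  by rewrite subr0 ltxx.
apply: conv_hull_sub => //.
by apply/convex_setP => _ _ s t _ _ _ -> ->; rewrite /= !scaler0 addr0.
Qed.

End SCD_unit_ball.

(** * The l1-sum *)

Section l1_maps.
Variables (K : numFieldType) (X Y : normedModType K).

(** The product X * Y carries another norm; maps declared on the l1-sum itself
    receive their linear structures over the right normed space. *)
Definition l1_fst (z : l1sum X Y) : X := z.1.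
Definition l1_inl (x : X) : l1sum X Y := (x, 0).
Definition l1_inr (y : Y) : l1sum X Y := (0, y).
Definition l1_swap (z : l1sum X Y) : l1sum Y X := (z.2, z.1).

Let l1_fst_linear : linear l1_fst. Proof. by []. Qed.
HB.instance Definition _ :=
  GRing.isLinear.Build K (l1sum X Y) X _ l1_fst l1_fst_linear.

Let l1_inl_linear : linear l1_inl.
Proof. by move=> k x x'; congr pair; rewrite /= scaler0 addr0. Qed.
HB.instance Definition _ :=
  GRing.isLinear.Build K X (l1sum X Y) _ l1_inl l1_inl_linear.

Let l1_swap_linear : linear l1_swap. Proof. by []. Qed.
HB.instance Definition _ :=
  GRing.isLinear.Build K (l1sum X Y) (l1sum Y X) _ l1_swap l1_swap_linear.

Lemma l1_normE (z : l1sum X Y) : `|z| = `|z.1| + `|z.2|. Proof. by []. Qed.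

Lemma l1_norm_inl x : `|l1_inl x| = `|x|.
Proof. by rewrite l1_normE normr0 addr0. Qed.

Lemma l1_norm_inr y : `|l1_inr y| = `|y|.
Proof. by rewrite l1_normE normr0 add0r. Qed.

Lemma l1_norm_fst z : `|l1_fst z| <= `|z|.
Proof. by rewrite l1_normE lerDl. Qed.

End l1_maps.

Section SCD_l1sum.
Variables (R : realType) (K : numFieldType) (re : K -> R).
Hypothesis hK : scalar_field re.

Lemma SCD_l1sum_swap (X Y : normedModType K) (a : X) (b : Y) :
  SCD re (unit_ball (l1sum X Y)) (a, b) ->
  SCD re (unit_ball (l1sum Y X)) (b, a).
Proof.
apply: (@SCD_isometry _ _ _ hK _ _ (@l1_swap K X Y) (@l1_swap K Y X)).
- by case.
- by case.
- by move=> z; rewrite !l1_normE addrC.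
Qed.

Variables X Y : normedModType K.

(** With s the supremum of Re f on the ball, Re f x <= s |x|, so a threshold of
    at least (1 - e) s > 0 forces |x| > 1 - e, which leaves less than e for the
    second coordinate.  The point x0 ensures s > 0. *)
Lemma slice_l1sum_near_axis (f : {linear X -> K^o}) (x0 x1 : X) (c e : R) :
    continuous f -> unit_ball X x0 -> 0 < re (f x0) ->
    unit_ball X x1 -> c < re (f x1) -> 0 < e ->
  exists T, [/\ is_slice re (unit_ball (l1sum X Y)) T, T !=set0 &
    forall z, T z -> c < re (f z.1) /\ re `|z.2| < e].
Proof.
move=> cf x01 fx0 x11 fx1 e0.
pose E := [set re (f x) | x in unit_ball X]; pose s := sup E.
have supE : has_sup E := has_sup_unit_ball hK cf.
have fs x : unit_ball X x -> re (f x) <= s.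
  by move=> ?; apply: sup_upper_bound => //; exists x.
have s0 : 0 < s by rewrite (lt_le_trans fx0) ?fs.
have fns x : re (f x) <= re `|x| * s.
  rewrite -[x in leLHS]normalizeK linearZ/= (reM_ge0 hK)//.
  by rewrite ler_wpM2l ?(re_ge0 hK)// fs//; exact: unit_ball_normalize.
(* Both requirements hold above c', and s > c' makes the slice nonempty. *)
pose c' := Num.max c ((1 - e) * s).
have c's : c' < s.
  by rewrite gt_max (lt_le_trans fx1) ?fs//= gtr_pMl// gtrDl oppr_lt0.
exists (ball_slice re (f \o @l1_fst K X Y : {linear l1sum X Y -> K^o}) c').
split.
- apply: (is_slice_ball_slice hK) => [z|].
    apply: continuous_comp; last exact: cf.
    by apply: contraction_continuous; exact: l1_norm_fst.
  have [_ [x x1' <-] c'x] := sup_gt supE.1 c's.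
  by exists (l1_inl Y x); split => //; rewrite /unit_ball/= l1_norm_inl.
- have [_ [x x1' <-] c'x] := sup_gt supE.1 c's.
  by exists (l1_inl Y x); split => //; rewrite /unit_ball/= l1_norm_inl.
move=> z [z1]; rewrite /= gt_max => /andP[-> esz]; split=> //.
have : re (`|z.1| + `|z.2|) <= 1 by rewrite -(re1 hK); apply: (re_le hK).
rewrite (reD hK); have := lt_le_trans esz (fns z.1).
rewrite ltr_pM2r//; lra.
Qed.

(** Lifting each slice of B_X to slices of B_Z that shrink towards the first
    axis makes the second coordinate of chosen points as small as desired. *)
Lemma SCD_l1sum_inl (a : X) : a != 0 ->
  SCD re (unit_ball X) a -> SCD re (unit_ball (l1sum X Y)) (a, 0).
Proof.
move=> a_neq0 aS.
have [f0 [x0 [cf0 x01 fx0]]] := SCD_functional_gt0 hK a_neq0 aS.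
case: aS => a1 [V [sV [V0 dV]]].
(* A functional that is nowhere positive on the ball vanishes, so its slice is
   the whole ball; any slice near the axis is then below it, and f0 gives one. *)
have lift (nk : nat * nat) : exists T,
    [/\ is_slice re (unit_ball (l1sum X Y)) T, T !=set0 &
    forall z, T z -> V nk.1 z.1 /\ re `|z.2| < nk.2.+1%:R^-1].
  case: nk => n k /=; have [f [c [cf Vn]]] := ball_slice_of_slice (sV n).
  have [x1] := (V0 n).1; rewrite Vn => -[x11 cx1].
  have z1P T z : is_slice re (unit_ball (l1sum X Y)) T -> T z -> unit_ball X z.1.
    move=> [g [al [_ _ ->]]] [z1 _]; exact: le_trans (l1_norm_fst z) z1.
  have k0 : 0 < k.+1%:R^-1 :> R by rewrite invr_gt0.
  have [[x [x1' fx]]|nf] := pselect (exists x, unit_ball X x /\ 0 < re (f x)).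
    have [T [sT T0 TP]] := slice_l1sum_near_axis cf x1' fx x11 cx1 k0.
    exists T; split=> // z Tz; have [? ?] := TP z Tz.
    by split=> //; split=> //; exact: z1P Tz.
  have [T [sT T0 TP]] := slice_l1sum_near_axis cf0 x01 fx0 x01 fx0 k0.
  exists T; split=> // z Tz; have [_ ?] := TP z Tz; split=> //.
  have z1 := z1P _ _ sT Tz; split=> //.
  have fle0 x : unit_ball X x -> re (f x) <= 0.
    by move=> ?; rewrite leNgt; apply/negP => ?; apply: nf; exists x.
  rewrite (lt_le_trans cx1)// (le_trans (fle0 _ x11))//.
  by rewrite -oppr_le0 -(reN hK) -linearN fle0// /unit_ball/= normrN.
have [T TP] := choice lift.
apply: (@SCD_countable _ _ _ _ _ (0%N, 0%N) _ _ T).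
- by rewrite /unit_ball/= (l1_norm_inl Y).
- by move=> nk; have [] := TP nk.
- by move=> nk; have [] := TP nk.
move=> B B1 BT; apply/closure_normP => e e0.
pose e2 := e / 2; have e20 : 0 < e2 by rewrite divr_gt0.
pose B' := [set x | exists2 y, `|y| <= e2 & B (x, y)].
have /closure_normP/(_ _ e20)[x B'x ax] : closure (conv_hull B') a.
  apply: dV => [x [y _ /B1]|n].
    by apply: le_trans; exact: (l1_norm_fst (x, y)).
  have [k ke] := ltr_add_invr (re_gt0 hK e20).
  have [[x y] [Bxy Txy]] := BT (n, k).
  have [_ _ /(_ _ Txy)[/= Vx yk]] := TP (n, k).
  exists x; split=> //; exists y => //.
  apply/ltW/(lt_re hK) => //; first exact: ltW.
  by rewrite (lt_trans yk)//; rewrite add0r in ke.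
have [y ye Bxy] : exists2 y, `|y| <= e2 & conv_hull B (x, y).
  move: x B'x {ax}; apply: conv_hull_sub => [|x [y ye Bxy]].
    apply/convex_setP => x x' s t s0 t0 st [y ye Bxy] [y' ye' Bxy'].
    exists (s *: y + t *: y').
      rewrite (le_trans (ler_normD _ _))// !normrZ !ger0_norm//.
      by rewrite -[leRHS]mul1r -st mulrDl lerD// ler_wpM2l.
    have /convex_setP cB := @convex_conv_hull _ _ B.
    exact: (cB (x, y) (x', y')).
  by exists y => //; exact: sub_conv_hull.
exists (x, y) => //.
rewrite l1_normE/= sub0r normrN [ltRHS](splitr e).
by rewrite ltr_leD.
Qed.

(** Otherwise Re h <= c on both axes balls, where c >= 0 because 0 lies in them;
    writing z as |z.1| u + |z.2| v with u and v on these balls would give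
    Re h z <= (|z.1| + |z.2|) c <= c on the whole ball. *)
Lemma slice_l1sum_meets_axes (h : {linear l1sum X Y -> K^o}) (c : R) :
    ball_slice re h c !=set0 ->
  (exists x, unit_ball X x /\ c < re (h (x, 0))) \/
  (exists y, unit_ball Y y /\ c < re (h (0, y))).
Proof.
move=> [z [z1 cz]]; apply: contrapT => /not_orP[nx ny].
have xc x : unit_ball X x -> re (h (x, 0)) <= c.
  by move=> ?; rewrite leNgt; apply/negP => ?; apply: nx; exists x.
have yc y : unit_ball Y y -> re (h (0, y)) <= c.
  by move=> ?; rewrite leNgt; apply/negP => ?; apply: ny; exists y.
have c0 : 0 <= c.
  rewrite -(re0 hK) -[in leLHS](linear0 h); apply: xc; exact: unit_ball0.
move: cz; apply/negP; rewrite -leNgt.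
have -> : z = `|z.1| *: ((`|z.1|^-1 *: z.1, 0) : l1sum X Y) +
              `|z.2| *: ((0, `|z.2|^-1 *: z.2) : l1sum X Y).
  have := normalizeK z.1; have := normalizeK z.2.
  case: z z1 => x y /= _ yE xE.
  by congr pair; rewrite /= scaler0 ?addr0 ?add0r.
rewrite linearD !linearZ/= (reD hK) !(reM_ge0 hK)//.
have zc : (re `|z.1| + re `|z.2|) * c <= c.
  by rewrite ler_piMl// -(reD hK) -(re1 hK); apply: (re_le hK).
rewrite (le_trans _ zc)// mulrDl lerD// ler_wpM2l ?(re_ge0 hK)//.
  by apply: xc; exact: unit_ball_normalize.
by apply: yc; exact: unit_ball_normalize.
Qed.

(** Points with such a representation form a convex set containing both pieces.
    The second coordinate is recorded by its norm alone, since t B_Y consists of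
    all vectors of norm at most t.  Nonemptiness of B provides u for the points
    of the second axis. *)
Lemma conv_hull_l1_axes (B : set X) (z : l1sum X Y) : B !=set0 ->
    conv_hull (@l1_inl K X Y @` B `|` @l1_inr K X Y @` unit_ball Y) z ->
  exists s t u, [/\ 0 <= s, 0 <= t, s + t = 1, conv_hull B u &
    z.1 = s *: u /\ `|z.2| <= t].
Proof.
move=> [x0 /sub_conv_hull Bx0]; move: z; apply: conv_hull_sub; last first.
  move=> _ [[x Bx <-]|[y y1 <-]].
    exists 1, 0, x; rewrite addr0 scale1r/= normr0.
    by split=> //; exact: sub_conv_hull.
  by exists 0, 1, x0; rewrite add0r scale0r/=.
apply/convex_setP => z z' p q p0 q0 pq.
move=> [s [t [u [s0 t0 st Bu [zu zt]]]]].
move=> [s' [t' [u' [s'0 t'0 st' Bu' [zu' zt']]]]].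
have [w Bw wE] := convex_scaled_sum (@convex_conv_hull _ _ B) Bu Bu'
  (mulr_ge0 p0 s0) (mulr_ge0 q0 s'0).
exists (p * s + q * s'), (p * t + q * t'), w; split.
- by rewrite addr_ge0 ?mulr_ge0.
- by rewrite addr_ge0 ?mulr_ge0.
- by rewrite addrACA -!mulrDr st st' !mulr1.
- by [].
- split; first by rewrite -wE /= zu zu' !scalerA.
  rewrite (le_trans (ler_normD _ _))// !normrZ !ger0_norm//.
  by rewrite lerD// ler_wpM2l.
Qed.

(** The slices of B_Z that meet the first axis trace a determining sequence for
    a/|a| on B_X; the others meet the second axis and are met by {0} x B_Y
    whatever B is. *)
Lemma SCD_l1sum_fst_normalize (a : X) (b : Y) : a != 0 -> `|a| + `|b| = 1 ->
  SCD re (unit_ball (l1sum X Y)) (a, b) ->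
  SCD re (unit_ball X) (`|a|^-1 *: a).
Proof.
move=> a_neq0 ab1 [_ [S [sS [S0 dS]]]].
have restrict n : exists V, [/\ is_slice re (unit_ball X) V, V !=set0 &
    forall B, B `&` V !=set0 ->
    (@l1_inl K X Y @` B `|` @l1_inr K X Y @` unit_ball Y) `&` S n !=set0].
  have [h [c [ch Sn]]] := ball_slice_of_slice (sS n).
  have [[x [x1 cx]]|nx] := pselect (exists x, unit_ball X x /\ c < re (h (x, 0))).
    exists (ball_slice re (h \o @l1_inl K X Y : {linear X -> K^o}) c); split.
    - apply: (is_slice_ball_slice hK) => [z|]; last by exists x.
      apply: continuous_comp; last exact: ch.
      by apply: contraction_continuous => x'; rewrite l1_norm_inl.
    - by exists x.
    move=> B [x' [Bx' [x'1 cx']]]; exists (l1_inl Y x'); rewrite Sn; split.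
      by left; exists x'.
    by split=> //; rewrite /unit_ball/= l1_norm_inl.
  (* S n meets the second axis, where all of B_Y is available, so V may be the
     largest slice of B_X. *)
  exists (unit_ball X); split.
  - exact: (is_slice_unit_ball hK).
  - by exists 0; exact: unit_ball0.
  move=> B _.
  have [[x [x1 cx]]|[y [y1 cy]]] : (exists x, unit_ball X x /\ c < re (h (x, 0)))
      \/ exists y, unit_ball Y y /\ c < re (h (0, y)).
  - by apply: slice_l1sum_meets_axes; rewrite -Sn; exact: (S0 n).1.
  - by case: nx; exists x.
  exists (l1_inr X y); rewrite Sn; split; first by right; exists y.
  by split=> //; rewrite /unit_ball/= l1_norm_inr.
have [V VP] := choice restrict.
apply: (@SCD_countable _ _ _ _ _ 0%N _ _ V).
- exact: unit_ball_normalize.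
- by move=> n; have [] := VP n.
- by move=> n; have [] := VP n.
move=> B B1 BV; have B0 : B !=set0 by have [x [Bx _]] := BV 0%N; exists x.
have a0 : 0 < `|a| by rewrite normr_gt0.
apply/closure_normP => e e0.
(* After multiplying by |a|, the two errors |a - s u| and |s - |a|| must add up
   to at most e |a|. *)
pose d := e * `|a| / 2; have d0 : 0 < d by rewrite divr_gt0// mulr_gt0.
have /closure_normP/(_ _ d0)[z] : closure
    (conv_hull (@l1_inl K X Y @` B `|` @l1_inr K X Y @` unit_ball Y)) (a, b).
  apply: dS => [_ [[x /B1 x1 <-]|[y y1 <-]]|n].
  - by rewrite /unit_ball/= l1_norm_inl.
  - by rewrite /unit_ball/= l1_norm_inr.
  - by have [_ _] := VP n; apply.
move=> /(conv_hull_l1_axes B0)[s [t [u [s0 t0 st Bu [zu zt]]]]].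
rewrite l1_normE/= zu => abz.
have u1 : `|u| <= 1.
  exact: (conv_hull_sub (@convex_unit_ball _ _) B1) Bu.
have ad : `|a - s *: u| < d by apply: le_lt_trans abz; rewrite lerDl.
have bd : `|b - z.2| < d by apply: le_lt_trans abz; rewrite lerDr.
exists u => //.
(* |a| <= s + |a - s u| and |b| <= t + |b - z.2| bound s from both sides, as
   |a| + |b| = s + t. *)
have as_le : `|a| <= s + `|a - s *: u|.
  rewrite -[a in leLHS](subrK (s *: u)) addrC (le_trans (ler_normD _ _))// lerD//.
  by rewrite normrZ ger0_norm// ler_piMr.
have bt_le : `|b| <= t + `|b - z.2|.
  by rewrite -[b in leLHS](subrK z.2) addrC (le_trans (ler_normD _ _))// lerD.
have sa : `|s - `|a| | < d.
  rewrite real_ltr_distl ?realB ?ger0_real//.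
  apply/andP; split.
    by rewrite ltrBlDr (le_lt_trans as_le)// ltrD2l.
  rewrite -subr_gt0 (_ : _ - _ = t + d - `|b|).
    by rewrite subr_gt0 (le_lt_trans bt_le)// ltrD2l.
  have -> : `|a| = 1 - `|b| by rewrite -ab1 addrK.
  have -> : s = 1 - t by rewrite -st addrK.
  ring.
rewrite -(ltr_pM2r a0) mulrC -[X in X * _ < _]normr_id -normrZ.
rewrite scalerBr normalizeK.
rewrite (_ : a - _ = (a - s *: u) + (s - `|a|) *: u); last first.
  by rewrite scalerBl addrA subrK.
rewrite (le_lt_trans (ler_normD _ _))// normrZ [ltRHS](splitr (e * `|a|)).
by rewrite ltrD// (le_lt_trans _ sa)// ler_piMr.
Qed.

End SCD_l1sum.

Theorem proposition3p5 (R : realType) (K : numFieldType) (re : K -> R)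
    (hK : scalar_field re) (X Y : completeNormedModType K) (a : X) (b : Y)
    (a_neq0 : a != 0) (b_neq0 : b != 0)
    (ab_sphere : unit_sphere (l1sum X Y) (a, b)) :
  SCD re (unit_ball (l1sum X Y)) (a, b) <->
  SCD re (unit_ball X) (`|a|^-1 *: a) /\ SCD re (unit_ball Y) (`|b|^-1 *: b).
Proof.
have ab1 : `|a| + `|b| = 1 by exact: ab_sphere.
split=> [ab|[aS bS]].
  split; first exact: (SCD_l1sum_fst_normalize hK a_neq0 ab1 ab).
  apply: (SCD_l1sum_fst_normalize hK b_neq0); last exact: (SCD_l1sum_swap hK ab).
  by rewrite addrC.
have a'0 : `|a|^-1 *: a != 0 by rewrite scaler_eq0 invr_eq0 normr_eq0 orbb.
have b'0 : `|b|^-1 *: b != 0 by rewrite scaler_eq0 invr_eq0 normr_eq0 orbb.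
have a'S := SCD_l1sum_inl hK Y a'0 aS.
have b'S := SCD_l1sum_swap hK (SCD_l1sum_inl hK X b'0 bS).
have -> : (a, b) = `|a| *: ((`|a|^-1 *: a, 0) : l1sum X Y) +
                   `|b| *: ((0, `|b|^-1 *: b) : l1sum X Y).
  by congr pair; rewrite /= scaler0 ?addr0 ?add0r normalizeK.
have /convex_setP := convex_SCD (re := re) (@convex_unit_ball K (l1sum X Y)).
by apply.
Qed.
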